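(* Let $\varepsilon$ be a constant with $0<\varepsilon<1$, and let $\ell$ be an integer with $\ell\geq \frac{2}{9}(\theta-3)(1-\varepsilon)+1$, where $\theta=\theta(\varepsilon)$ is the largest real solution of $x^{3}e^{-\frac{1}{9}\varepsilon^{2}(x-3)}=1$. Then, with $N=\max\left\{6,\left\lceil\frac{9(\ell-1)}{2(1-\varepsilon)}+3\right\rceil\right\}$, we have $rx_{3,\ell}(K_{n})=3$ for every integer $n\geq N$.
   Context: An edge-coloring of a graph $G$ is any map $c:E(G)\to\{1,\dots,t\}$ (adjacent edges may receive the same color). A tree is rainbow if no two of its edges have the same color. For $S\subseteq V(G)$, a rainbow $S$-tree is a rainbow tree in $G$ whose vertex set contains $S$. $S$-trees $T_1,\dots,T_\ell$ are internally disjoint if $E(T_i)\cap E(T_j)=\emptyset$ and $V(T_i)\cap V(T_j)=S$ for all $i\ne j$. For $k\ge2$, $\ell\ge1$, $rx_{k,\ell}(G)$ is the minimum number of colors in an edge-coloring of $G$ such that for every $k$-subset $S\subseteq V(G)$ there exist $\ell$ internally disjoint rainbow $S$-trees. $K_n$ is the complete graph on $n$ vertices. *)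

(* Defs.v *)
From HB Require Import structures.
From mathcomp Require Import all_boot all_order all_algebra.
From mathcomp Require Import all_classical all_reals all_analysis.

Set Implicit Arguments.
Unset Strict Implicit.
Unset Printing Implicit Defensive.

Import Order.TTheory GRing.Theory Num.Theory.

Record sgraph := SGraph {
  vertex :> finType;
  edges : {set {set vertex}};
  edges_card2 : forall e, e \in edges -> #|e| = 2 }.

Definition complete_edges (n : nat) : {set {set 'I_n}} :=
  [set e : {set 'I_n} | #|e| == 2].

Lemma complete_edges_card2 (n : nat) (e : {set 'I_n}) :
  e \in complete_edges n -> #|e| = 2.
Proof. by rewrite inE => /eqP. Qed.

Definition complete_graph (n : nat) : sgraph :=
  @SGraph 'I_n (complete_edges n) (@complete_edges_card2 n).

Definition adj (T : finType) (E : {set {set T}}) : rel T :=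
  [rel x y | [set x; y] \in E].

Record subgraph (G : sgraph) := Subgraph {
  sub_V : {set G};
  sub_E : {set {set G}};
  sub_E_sub : sub_E \subset edges G;
  sub_E_V : forall e, e \in sub_E -> e \subset sub_V }.

Definition connected_sub (G : sgraph) (H : subgraph G) : Prop :=
  sub_V H != finset.set0 /\
  {in sub_V H &, forall x y, connect (adj (sub_E H)) x y}.

(* Vertex sequences [:: x; y] going back and forth along one edge also
   satisfy ucycle; graph cycles are those of length at least 3. *)
Definition acyclic_sub (G : sgraph) (H : subgraph G) : Prop :=
  forall p : seq G, ucycle (adj (sub_E H)) p -> size p < 3.

Definition is_tree (G : sgraph) (H : subgraph G) : Prop :=
  connected_sub H /\ acyclic_sub H.

(* Only the values of c on edges G matter. *)
Definition edge_coloring (G : sgraph) (t : nat) (c : {set G} -> nat) : Prop :=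
  {in edges G, forall e, 1 <= c e <= t}.

Definition rainbow (G : sgraph) (c : {set G} -> nat) (H : subgraph G) : Prop :=
  {in sub_E H &, injective c}.

Definition rainbow_Stree (G : sgraph) (c : {set G} -> nat) (S : {set G})
    (H : subgraph G) : Prop :=
  [/\ is_tree H, rainbow c H & S \subset sub_V H].

Definition internally_disjoint (G : sgraph) (S : {set G}) (l : nat)
    (T : 'I_l -> subgraph G) : Prop :=
  forall i j : 'I_l, i != j ->
    sub_E (T i) :&: sub_E (T j) = finset.set0 /\
    sub_V (T i) :&: sub_V (T j) = S.

Definition rx_colorable (k l : nat) (G : sgraph) (t : nat) : Prop :=
  exists2 c : {set G} -> nat, edge_coloring t c &
    forall S : {set G}, #|S| = k ->
      exists2 T : 'I_l -> subgraph G,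
        internally_disjoint S T & forall i, rainbow_Stree c S (T i).

(* "rx_{k,l}(G) exists and equals m"; for small graphs no number of colors may
   suffice, so rx is given as the graph of a partial function. *)
Definition is_rx (k l : nat) (G : sgraph) (m : nat) : Prop :=
  rx_colorable k l G m /\ forall t : nat, rx_colorable k l G t -> m <= t.

Local Open Scope ring_scope.

Definition theta_equation (R : realType) (eps x : R) : Prop :=
  x ^+ 3 * expR (- (1 / 9 * eps ^+ 2 * (x - 3))) = 1.

Definition is_theta (R : realType) (eps theta : R) : Prop :=
  theta_equation eps theta /\
  forall x : R, theta_equation eps x -> x <= theta.

(* Main.v *)
(* Color the edges uniformly at random with three colors.  For a triple S, the
   stars joining a vertex v outside S to S are internally disjoint S-trees, and
   each is rainbow with probability 2/9 independently of the others.  The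
   exponential moment with parameter eps bounds the probability that at most
   (1 - eps) * 2/9 * (n - 3) >= l - 1 of them are rainbow by
   exp (- eps^2 (n - 3) / 9), and the union bound over at most n^3 triples
   succeeds because n >= theta.  Independence enters as the invariance of sums
   over all colorings under resampling the color of one edge.  Conversely theta > 3 forces l >= 2, and with two colors a rainbow
   S-tree consists of two edges inside S, so no two of them are disjoint. *)

Require Import Defs.
From HB Require Import structures.
From mathcomp Require Import all_boot all_order all_algebra.
From mathcomp Require Import all_classical all_reals all_analysis.
From mathcomp Require Import ring lra zify.

Set Implicit Arguments.
Unset Strict Implicit.
Unset Printing Implicit Defensive.

Import mathcomp.boot.fintype mathcomp.boot.finset.
Import Order.TTheory GRing.Theory Num.Theory.
Import numFieldNormedType.Exports.

Local Open Scope ring_scope.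

(** * Second-order estimates for the exponential *)

Lemma expR_ge_order2 (R : realType) (x : R) :
  0 <= x -> 1 + x + x ^+ 2 / 2 <= expR x.
Proof.
move=> x0; have nd : nondecreasing_seq (series (exp_coeff x)).
  apply/nondecreasing_seqP => n.
  by rewrite /series /= big_nat_recr//= lerDl exp_coeff_ge0.
have := nondecreasing_cvgn_le nd (is_cvg_series_exp_coeff x) 3.
rewrite /series /= !big_nat_recr//= big_geq// /exp_coeff /= /expR.
by rewrite expr0 expr1 add0r !divr1.
Qed.

(** The product (1 + x + x^2/2)(1 - x + x^2/2) = 1 + x^4/4 exceeds 1, so the lower bound on [expR x]
    inverts to this one. *)
Lemma expRN_lt_order2 (R : realType) (x : R) :
  0 < x -> expR (- x) < 1 - x + x ^+ 2 / 2.
Proof.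
move=> x0; rewrite expRN.
have e2 := expR_ge_order2 (ltW x0).
have q0 : 0 < 1 - x + x ^+ 2 / 2 by nra.
rewrite -ltf_pV2 ?posrE ?invr_gt0 ?expR_gt0// invrK.
apply: lt_le_trans e2.
rewrite -(ltr_pM2r q0) mulVf ?gt_eqF//.
have -> : (1 + x + x ^+ 2 / 2) * (1 - x + x ^+ 2 / 2) =
    1 + (x ^+ 2) ^+ 2 / 4 :> R by field.
have : 0 < (x ^+ 2) ^+ 2 by rewrite !exprn_gt0.
lra.
Qed.

(** * The threshold theta *)

Definition theta_fun (R : realType) (eps x : R) : R :=
  x ^+ 3 * expR (- (1 / 9 * eps ^+ 2 * (x - 3))).

Lemma continuous_theta_fun (R : realType) (eps : R) :
  continuous (theta_fun eps).
Proof.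
move=> x; apply: cvgM; first exact: exprn_continuous.
apply: continuous_comp; last exact: continuous_expR.
apply: cvgN; apply: cvgM; first exact: cvg_cst.
by apply: cvgB; [exact: cvg_id | exact: cvg_cst].
Qed.

(** The exponential beats the cube: e^(a m) = (e^(a m/4))^4 is at least the quartic (a m/4)^4. *)
Lemma theta_fun_eventually_le1 (R : realType) (eps x : R) :
  0 < eps -> exists2 y, x <= y & theta_fun eps y <= 1.
Proof.
move=> eps0; set a := 1 / 9 * eps ^+ 2.
have a0 : 0 < a by rewrite mulr_gt0 ?exprn_gt0 // divr_gt0.
have a4 : 0 < a ^+ 4 by rewrite exprn_gt0.
(* [m] is y - 3. From m >= 1 follows m + 3 <= 4 m, and m >= 4^7 / a^4 is exactly (4 m)^3 <= (a
   m/4)^4. *)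
pose m := `|x| + 1 + 4 ^+ 7 / a ^+ 4.
have k0 : 0 < 4 ^+ 7 / a ^+ 4 by rewrite divr_gt0.
have m1 : 1 <= m by rewrite /m; have := normr_ge0 x; lra.
exists (m + 3); first by rewrite /m; have := ler_norm x; lra.
rewrite /theta_fun -/a addrK expRN ler_pdivrMr ?expR_gt0// mul1r.
apply: (@le_trans _ _ ((a * m / 4) ^+ 4)); last first.
  have -> : expR (a * m) = expR (a * m / 4) ^+ 4.
    by rewrite -expRM_natl; congr expR; field.
  have := expR_ge1Dx (a * m / 4) => h.
  have am0 : 0 <= a * m by rewrite mulr_ge0 //; lra.
  by rewrite lerXn2r ?nnegrE ?expR_ge0//; lra.
apply: (@le_trans _ _ ((4 * m) ^+ 3)); first by rewrite lerXn2r ?nnegrE //; lra.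
have -> : (a * m / 4) ^+ 4 = (a ^+ 4 * m) * (m ^+ 3 / 4 ^+ 4) by field.
have -> : (4 * m) ^+ 3 = 4 ^+ 7 * (m ^+ 3 / 4 ^+ 4) by field.
rewrite ler_pM2r; last by rewrite divr_gt0 ?exprn_gt0//; lra.
rewrite mulrC -ler_pdivrMr// /m.
by have := normr_ge0 x; lra.
Qed.

(** Intermediate value theorem between [x] and a later point where [theta_fun] is at most 1. *)
Lemma theta_root_gt (R : realType) (eps x : R) :
  0 < eps -> 1 < theta_fun eps x -> exists2 y, x < y & theta_equation eps y.
Proof.
move=> eps0 fx; have [y xy fy] := theta_fun_eventually_le1 x eps0.
have [||c] := @IVT R (theta_fun eps) x y 1 xy.
- exact/continuous_subspaceT/continuous_theta_fun.
- by rewrite ge_min fy orbT le_max (ltW fx).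
rewrite in_itv /= => /andP[xc _] fc; exists c => //.
rewrite lt_neqAle xc andbT; apply: contraTneq fx => ->.
by rewrite fc ltxx.
Qed.

(** At 3 the function takes the value 27 > 1, so a root lies beyond 3. *)
Lemma theta_gt3 (R : realType) (eps theta : R) :
  0 < eps -> is_theta eps theta -> 3 < theta.
Proof.
move=> eps0 [_ maxth]; have [|y y3 /maxth] := @theta_root_gt R eps 3 eps0.
  by rewrite /theta_fun subrr mulr0 oppr0 expR0 mulr1; lra.
exact: lt_le_trans.
Qed.

Lemma theta_fun_le1 (R : realType) (eps theta x : R) :
  0 < eps -> is_theta eps theta -> theta <= x -> theta_fun eps x <= 1.
Proof.
move=> eps0 [_ maxth] thx; rewrite leNgt; apply/negP => /(theta_root_gt eps0).
by move=> [y xy /maxth]; rewrite leNgt (le_lt_trans thx xy).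
Qed.

(** * Independence by resampling the color of one edge *)

Section Resampling.

Variables (R : realType) (E : finType).
Local Notation coloring := {ffun E -> 'I_3}.

Definition recolor (F : coloring) (e : E) (j : 'I_3) : coloring :=
  [ffun x => if x == e then j else F x].

Lemma recolor_same (F : coloring) (e : E) (j : 'I_3) : recolor F e j e = j.
Proof. by rewrite ffunE eqxx. Qed.

Lemma recolor_other (F : coloring) (e x : E) (j : 'I_3) :
  x != e -> recolor F e j x = F x.
Proof. by rewrite ffunE => /negPf->. Qed.

(** Exchanging the fresh color [j] with the old color [F e] is an involution on pairs; after
    reindexing, each [F] is counted once for each of the three [j]. *)
Lemma sum_recolor (f : coloring -> R) (e : E) :
  \sum_F \sum_j f (recolor F e j) = 3 * \sum_F f F.
Proof.
pose swap (p : coloring * 'I_3) := (recolor p.1 e p.2, p.1 e).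
have swapK : involutive swap.
  move=> [F j]; rewrite /swap /= recolor_same; congr pair.
  by apply/ffunP => x; rewrite !ffunE; case: eqP => [->|].
rewrite pair_bigA (reindex_inj (inv_inj swapK)) /=.
have -> : \sum_(p : coloring * 'I_3) f (recolor (recolor p.1 e p.2) e (p.1 e)) =
    \sum_(p : coloring * 'I_3) f p.1.
  apply: eq_bigr => -[F j] _ /=; congr f.
  by have := swapK (F, j); rewrite /swap /= => -[].
rewrite -(pair_bigA _ (fun F (_ : 'I_3) => f F)) mulr_sumr.
by apply: eq_bigr => F _; rewrite sumr_const card_ord mulr_natl.
Qed.

Lemma sum_rainbow_weights (q : R) :
  \sum_(i < 3) \sum_(j < 3) \sum_(k < 3) (if uniq [:: i; j; k] then q else 1) =
  21 + 6 * q.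
Proof. by rewrite !big_ord_recl !big_ord0 /=; ring. Qed.

(* Three independent uniform colors are distinct with probability 6/27 = 2/9. *)
Lemma sum_mul_rainbow (f : coloring -> R) (e1 e2 e3 : E) (q : R) :
    uniq [:: e1; e2; e3] ->
    (forall F e j, e \in [:: e1; e2; e3] -> f (recolor F e j) = f F) ->
  \sum_F f F * (if uniq [:: F e1; F e2; F e3] then q else 1) =
  (1 - 2 / 9 * (1 - q)) * \sum_F f F.
Proof.
rewrite /= !inE !andbT negb_or => /andP[/andP[e12 e13] e23] finv.
pose h F := f F * (if uniq [:: F e1; F e2; F e3] then q else 1).
have h3 F i j k : h (recolor (recolor (recolor F e1 i) e2 j) e3 k) =
    f F * (if uniq [:: i; j; k] then q else 1).
  rewrite /h !finv ?inE ?eqxx ?orbT//.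
  rewrite recolor_same recolor_other// recolor_other// recolor_same.
  by rewrite recolor_other// recolor_same.
(* Each of the three resamplings triples the sum, hence 27; by [h3] the weight then depends on the
   fresh colors alone. *)
have : \sum_F \sum_i \sum_j \sum_k
     h (recolor (recolor (recolor F e1 i) e2 j) e3 k) = 27 * \sum_F h F.
  rewrite (sum_recolor
    (fun F => \sum_j \sum_k h (recolor (recolor F e2 j) e3 k))).
  rewrite (sum_recolor (fun F => \sum_k h (recolor F e3 k))) sum_recolor.
  by rewrite !mulrA -!natrM.
rewrite (eq_bigr (fun F => f F * (21 + 6 * q))); last first.
  move=> F _; rewrite -sum_rainbow_weights mulr_sumr; apply: eq_bigr => i _.
  rewrite mulr_sumr; apply: eq_bigr => j _.
  by rewrite mulr_sumr; apply: eq_bigr => k _.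
rewrite -mulr_suml => eqn.
apply: (@mulfI _ 27%:R); first by rewrite pnatr_eq0.
by rewrite -[LHS]eqn; field.
Qed.

End Resampling.

Lemma set2_inj (T : finType) (v : T) : injective (fun x => [set v; x]).
Proof.
move=> x y /= vxy; have : x \in [set v; y] by rewrite -vxy !inE eqxx orbT.
have : y \in [set v; x] by rewrite vxy !inE eqxx orbT.
by rewrite !inE => /orP[/eqP->|/eqP//] /orP[/eqP->|/eqP].
Qed.

Lemma set2_neq (T : finType) (v w x y : T) :
  w != v -> w != x -> [set w; y] != [set v; x].
Proof.
move=> wv wx; apply/eqP => /setP/(_ w).
by rewrite !inE eqxx (negPf wv) (negPf wx).
Qed.

(** * Exponential moment of the number of rainbow stars, and the union bound *)

Section RainbowStars.

Variables (R : realType) (n : nat).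
Local Notation coloring := {ffun {set 'I_n} -> 'I_3}.

Definition rainbow_star (F : coloring) (a b c v : 'I_n) : bool :=
  uniq [:: F [set v; a]; F [set v; b]; F [set v; c]].

(** For distinct [a], [b], [c] and uniform [F], the cardinality is binomial with n - 3 trials and
    success probability 2/9. *)
Definition rainbow_centers (F : coloring) (a b c : 'I_n) : {set 'I_n} :=
  [set v | (v \notin [:: a; b; c]) && rainbow_star F a b c v].

(** Induction on [s]: no star at another center of [s] contains an edge of the star at [v], so the
    factor of [v] splits off. *)
Lemma sum_star_weights (a b c : 'I_n) (q : R) (s : seq 'I_n) :
    uniq [:: a; b; c] -> uniq s -> {in s, forall v, v \notin [:: a; b; c]} ->
  \sum_(F : coloring) \prod_(v <- s) (if rainbow_star F a b c v then q else 1) =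
  (1 - 2 / 9 * (1 - q)) ^+ size s * #|coloring|%:R.
Proof.
move=> Uabc; elim: s => [_ _|v s IHs /= /andP[vs Us] sabc].
  by rewrite (eq_bigr (fun=> 1)) => [|F _]; rewrite ?big_nil// sumr_const mul1r.
under eq_bigr do rewrite big_cons mulrC.
rewrite sum_mul_rainbow => [||F e j].
- rewrite IHs//; first by rewrite exprS mulrA.
  by move=> w ws; apply: sabc; rewrite inE ws orbT.
- by have := map_inj_uniq (@set2_inj _ v) [:: a; b; c]; rewrite Uabc => ->.
- move=> ev; have {ev}[x xabc ->] :
      exists2 x, x \in [:: a; b; c] & e = [set v; x] by apply/mapP.
  apply: eq_big_seq => w ws.
  have /sabc wabc : w \in v :: s by rewrite inE ws orbT.
  have wv : w != v by apply: contraNneq vs => <-.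
  have wx : w != x by apply: contraNneq wabc => ->.
  by rewrite /rainbow_star !recolor_other// set2_neq.
Qed.

Lemma sum_centers_weights (a b c : 'I_n) (q : R) : uniq [:: a; b; c] ->
  \sum_(F : coloring) q ^+ #|rainbow_centers F a b c| =
  (1 - 2 / 9 * (1 - q)) ^+ (n - 3) * #|coloring|%:R.
Proof.
move=> Uabc; pose A := [predC [:: a; b; c]].
have <- : size (enum A) = (n - 3)%N.
  have := cardC (mem [:: a; b; c]); rewrite card_ord (card_uniqP Uabc).
  move=> /(congr1 (subn^~ 3)); rewrite /= addKn => <-.
  by rewrite -cardE; apply: eq_card => x; rewrite !inE.
rewrite -(@sum_star_weights a b c q) ?enum_uniq//; last first.
  by move=> v; rewrite mem_enum.
apply: eq_bigr => F _; rewrite big_enum /= -prodr_const -big_mkcondr /=.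
by apply: eq_bigl => v; rewrite !inE.
Qed.

(** Double counting replaces probability: if every coloring had a bad triple, that triple alone
    would make the sum of [q ^+ X F p] over [p] large for every [F], against the average of this sum
    over all colorings. *)
Lemma exists_coloring_many_rainbow_stars (eps : R) :
    (3 < n)%N -> 0 < eps -> theta_fun eps n%:R <= 1 ->
  exists F : coloring, forall a b c : 'I_n, uniq [:: a; b; c] ->
    2 / 9 * (n%:R - 3) * (1 - eps) < #|rainbow_centers F a b c|%:R.
Proof.
move=> n3 eps0 thn; apply: contrapT => noF.
(* [mu] is the expected number of rainbow stars of a triple. *)
pose mu : R := 2 / 9 * (n%:R - 3); pose q := expR (- eps).
have mu0 : 0 < mu by rewrite mulr_gt0 ?divr_gt0// subr_gt0 ltr_nat.
pose N : R := #|{: coloring}|%:R.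
have N0 : 0 < N.
  by rewrite ltr0n; apply/card_gt0P; exists [ffun=> ord0].
pose P (p : 'I_n * 'I_n * 'I_n) := uniq [:: p.1.1; p.1.2; p.2].
pose X F (p : 'I_n * 'I_n * 'I_n) := #|rainbow_centers F p.1.1 p.1.2 p.2|.
have q0 : 0 < q by apply: expR_gt0.
have low (F : coloring) :
    expR (- (eps * (mu * (1 - eps)))) <= \sum_(p | P p) q ^+ X F p.
  have [p Pp leX] : exists2 p, P p & (X F p)%:R <= mu * (1 - eps).
    apply: contrapT => noS; apply: noF; exists F => a b c Uabc.
    by rewrite ltNge; apply/negP => leX; apply: noS; exists (a, b, c).
  rewrite (bigD1 _ Pp) /=; apply: ler_wpDr.
    by apply: sumr_ge0 => r _; rewrite exprn_ge0// ltW.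
  by rewrite /q -expRM_natl ler_expR mulrN lerN2 mulrC ler_pM2l.
have : N * expR (- (eps * (mu * (1 - eps)))) <=
    \sum_(F : coloring) \sum_(p | P p) q ^+ X F p.
  by rewrite mulr_natl -sumr_const; apply: ler_sum => F _.
rewrite exchange_big.
rewrite (eq_bigr (fun=> (1 - 2 / 9 * (1 - q)) ^+ (n - 3) * N)); last first.
  by move=> p; exact: sum_centers_weights.
rewrite sumr_const => up.
have qlt := expRN_lt_order2 eps0; rewrite -/q in qlt.
have base : 0 <= 1 - 2 / 9 * (1 - q) by lra.
(* This is 1 + y <= e^y at y = - 2/9 (1 - q), raised to the power n - 3. *)
have pow : (1 - 2 / 9 * (1 - q)) ^+ (n - 3) <= expR (- ((1 - q) * mu)).
  have -> : - ((1 - q) * mu) = (- (2 / 9 * (1 - q))) * (n - 3)%:R.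
    by rewrite natrB ?(ltnW n3)// /mu; ring.
  by rewrite expRM_natr lerXn2r ?nnegrE ?expR_ge0// expR_ge1Dx.
have {}up : N * expR (- (eps * (mu * (1 - eps)))) <=
    N * (n%:R ^+ 3 * expR (- ((1 - q) * mu))).
  apply: (le_trans up); rewrite -[leLHS]mulr_natl mulrA mulrC ler_pM2l//.
  (* Triples are ordered; their crude count n^3 is the cubic factor of [theta_fun]. *)
  have cardP : (#|P|%:R : R) <= n%:R ^+ 3.
    rewrite -natrX ler_nat; apply: leq_trans (max_card _) _.
    by rewrite !card_prod !card_ord !expnS expn0 muln1 mulnA.
  by rewrite ler_pM ?ler0n ?exprn_ge0.
move: up; rewrite ler_pM2l// leNgt => /negP; apply.
have nR0 : (0 : R) < n%:R ^+ 3 by rewrite exprn_gt0// ltr0n (ltn_trans _ n3).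
(* Since eps^2 (n - 3)/9 = mu eps^2/2, the exponents differ by mu (1 - eps + eps^2/2 - q), positive
   by [expRN_lt_order2]. *)
apply: (@lt_le_trans _ _
  (theta_fun eps n%:R * expR (- (eps * (mu * (1 - eps)))))); last first.
  by rewrite ler_piMl// expR_ge0.
rewrite /theta_fun -mulrA -expRD ltr_pM2l// ltr_expR /mu.
have n30 : (0 : R) < n%:R - 3 by rewrite subr_gt0 ltr_nat.
rewrite -subr_gt0.
have -> : - (1 / 9 * eps ^+ 2 * (n%:R - 3)) -
    eps * (2 / 9 * (n%:R - 3) * (1 - eps)) - - ((1 - q) * (2 / 9 * (n%:R - 3)))
  = (2 / 9 * (n%:R - 3)) * (1 - eps + eps ^+ 2 / 2 - q) by field.
by rewrite mulr_gt0 ?subr_gt0// mulr_gt0// divr_gt0.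
Qed.

End RainbowStars.

(** * Stars as internally disjoint trees, and the upper bound *)

Section Star.

Variables (n : nat) (S : {set 'I_n}) (v : 'I_n).
Hypothesis vS : v \notin S.

Definition star_edges : {set {set 'I_n}} := [set [set v; x] | x in S].

Lemma star_edges_sub : star_edges \subset edges (complete_graph n).
Proof.
apply/subsetP => _ /imsetP[x xS ->]; rewrite inE cards2.
by have -> : v != x by apply: contraNneq vS => ->.
Qed.

Lemma star_edges_V (e : {set 'I_n}) : e \in star_edges -> e \subset v |: S.
Proof.
move=> /imsetP[x xS ->]; apply/subsetP => y.
by rewrite !inE => /orP[->//|/eqP->]; rewrite xS orbT.
Qed.

Definition star : subgraph (complete_graph n) :=
  @Subgraph (complete_graph n) (v |: S) star_edges star_edges_sub star_edges_V.

Lemma star_adj (x y : 'I_n) :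
  adj star_edges x y -> (x = v /\ y \in S) \/ (y = v /\ x \in S).
Proof.
move=> /imsetP[z zS xyvz].
have : x \in [set v; z] by rewrite -xyvz !inE eqxx.
have : y \in [set v; z] by rewrite -xyvz !inE eqxx orbT.
have : v \in [set x; y] by rewrite xyvz !inE eqxx.
have : z \in [set x; y] by rewrite xyvz !inE eqxx orbT.
rewrite !inE => /orP[]/eqP zE /orP[]/eqP vE _ _.
- by move: vS; rewrite vE -zE zS.
- by right; rewrite vE -zE.
- by left; rewrite vE -zE.
- by move: vS; rewrite vE -zE zS.
Qed.

(** Every edge joins [v] to [S]. In a cycle x, y, z, ... this forces y = v, and the vertex after z
    would have to be [v] again. *)
Lemma star_tree : is_tree star.
Proof.
split; last first.
  move=> [|x [|y [|z p]]]//; rewrite /ucycle /= => /andP[].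
  case/and3P => /star_adj xy /star_adj yz zp; rewrite !inE !negb_or => Up.
  case/andP: Up => /and3P[xy' xz _] /andP[/andP[yz' yp] _].
  case: xy => -[x_v y_S]; case: yz => -[y_v z_S].
  - by move: vS; rewrite -y_v y_S.
  - by rewrite x_v y_v eqxx in xz.
  - case: p yp zp => [_ /andP[/star_adj zx _]|w p].
      by case: zx => -[zv _]; move: vS; rewrite -zv ?z_S ?y_S.
    rewrite !inE negb_or => /andP[yw _] /andP[/star_adj[] [zv wS] _].
      by move: vS; rewrite -zv z_S.
    by rewrite x_v zv eqxx in yw.
  - by move: vS; rewrite -x_v z_S.
split; first by apply/set0Pn; exists v; rewrite /= !inE eqxx.
have adjC : symmetric (adj star_edges) by move=> x y; rewrite /adj /= setUC.
have adj_v (x : 'I_n) : x \in v |: S -> connect (adj star_edges) v x.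
  rewrite !inE => /orP[/eqP->|xS]; first exact: connect0.
  by apply: connect1; apply: imset_f.
move=> x y xV yV; apply: connect_trans (adj_v _ yV).
by rewrite (sym_connect_sym adjC) adj_v.
Qed.

End Star.

Lemma stars_internally_disjoint (n l : nat) (S : {set 'I_n})
    (w : 'I_l -> 'I_n) (wS : forall i, w i \notin S) :
  injective w ->
  @internally_disjoint (complete_graph n) S l (fun i => star (wS i)).
Proof.
move=> w_inj i j ij; have wij : w i != w j by apply: contraNneq ij => /w_inj->.
split.
  apply/setP => e; rewrite !inE; apply/negP => /andP[].
  move=> /imsetP[x xS ->] /imsetP[y yS] /eqP.
  by apply/negP; rewrite set2_neq//; apply: contraNneq (wS i) => ->.
apply/setP => x; rewrite !inE; case: (boolP (x \in S)); rewrite ?orbT// => _.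
by rewrite !orbF; apply/negP => /andP[/eqP->]; apply/negP.
Qed.

Lemma card3_seq (T : finType) (S : {set T}) : #|S| = 3 ->
  exists a b c, uniq [:: a; b; c] /\ S =i [:: a; b; c].
Proof.
rewrite cardE => S3; have := enum_uniq (mem S).
have memS : S =i enum S by move=> x; rewrite mem_enum.
case: (enum S) S3 memS => [|a [|b [|c [|]]]]// _ memS U.
by exists a, b, c.
Qed.

Lemma rx_colorable3 (n l : nat) (F : {ffun {set 'I_n} -> 'I_3}) :
    (forall a b c, uniq [:: a; b; c] -> (l <= #|rainbow_centers F a b c|)%N) ->
  rx_colorable 3 l (complete_graph n) 3.
Proof.
(* Colors in ['I_3] start at 0, those of an [edge_coloring] at 1. *)
move=> many; exists (fun e => (F e).+1).
  by move=> e _ /=; rewrite ltn_ord.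
move=> S /card3_seq[a [b [c [Uabc SE]]]].
have lX := many a b c Uabc.
pose w (i : 'I_l) : 'I_n := enum_val (widen_ord lX i).
have wX i : w i \in rainbow_centers F a b c by apply: enum_valP.
have wS i : w i \notin S by have := wX i; rewrite inE SE => /andP[].
have w_inj : injective w.
  by move=> i j /enum_val_inj/(congr1 val) /= /val_inj.
exists (fun i => star (wS i)); first exact: stars_internally_disjoint.
move=> i; split; [exact: star_tree | | exact: subsetUr].
move=> _ _ /imsetP[x xS ->] /imsetP[y yS ->] [] /val_inj Fxy.
have : rainbow_star F a b c (w i) by have := wX i; rewrite inE => /andP[].
rewrite SE in xS; rewrite SE in yS.
move=> U; congr [set _; _]; move: U Fxy xS yS.
rewrite /rainbow_star /= !inE !andbT negb_or.
move=> /andP[/andP[/eqP ab /eqP ac] /eqP bc] Fxy.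
by move=> /or3P[]/eqP xE /or3P[]/eqP yE; subst x y => //; congruence.
Qed.

(** * Two colors do not suffice for two trees *)

Lemma card_rainbow (G : sgraph) (t : nat) (c : {set G} -> nat)
    (H : subgraph G) :
  edge_coloring t c -> rainbow c H -> (#|sub_E H| <= t)%N.
Proof.
move=> ct cH; pose f e : 'I_t.+1 := inord (c e).
have cE e : e \in sub_E H -> (0 < c e < t.+1)%N.
  by move=> /(subsetP (sub_E_sub H)) /ct.
have f_inj : {in sub_E H &, injective f}.
  move=> e e' eH e'H /(congr1 val) /=; rewrite !inordK; first exact: cH.
  - by have /andP[] := cE _ e'H.
  - by have /andP[] := cE _ eH.
rewrite -(card_in_imset f_inj).
(* Color 0 never occurs, which lowers the bound from t + 1 to t. *)
suff : f @: sub_E H \subset [set~ ord0].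
  by move/subset_leq_card; rewrite cardsC1 card_ord.
apply/subsetP => _ /imsetP[e /cE /andP[ce0 cet] ->].
by rewrite !inE -val_eqE /= inordK// -lt0n.
Qed.

(** Otherwise [A] would be closed under adjacency, and a path from [x] could not reach [y]. *)
Lemma connected_crossing (G : sgraph) (H : subgraph G) (A : {set G}) (x y : G) :
    connected_sub H -> x \in sub_V H -> y \in sub_V H ->
    x \in A -> y \notin A ->
  exists u w, [/\ u \in A, w \notin A & [set u; w] \in sub_E H].
Proof.
move=> [_ conH] xV yV xA yA; apply: contrapT => nocross.
have adjC : symmetric (adj (sub_E H)) by move=> u w; rewrite /adj /= setUC.
have clA : fingraph.closed (adj (sub_E H)) A.
  apply: intro_closed; first exact: sym_connect_sym.
  move=> u w uw uA; apply/negPn/negP => wA.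
  by apply: nocross; exists u, w.
by have := closed_connect clA (conH x y xV yV); rewrite xA (negPf yA).
Qed.

(* Growing the component of a vertex along crossing edges uses up both edges
   and exhausts the vertex set after three vertices. *)
Lemma two_edge_connected_span (G : sgraph) (H : subgraph G) (S : {set G}) :
    connected_sub H -> #|S| = 3%N -> S \subset sub_V H -> (#|sub_E H| <= 2)%N ->
  sub_V H = S /\ #|sub_E H| = 2%N.
Proof.
move=> conH S3 SV E2.
have big (A : {set G}) : (#|A| < #|sub_V H|)%N ->
    exists2 y, y \in sub_V H & y \notin A.
  move=> AV; apply: contrapT => noy.
  suff /subset_leq_card : sub_V H \subset A by rewrite leqNgt AV.
  by apply/subsetP => y yV; apply/negPn/negP => yA; apply: noy; exists y.
have V3 : (3 <= #|sub_V H|)%N by rewrite -S3 subset_leq_card.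
have EV e y : e \in sub_E H -> y \in e -> y \in sub_V H.
  by move=> /(sub_E_V (s:=H)) /subsetP; apply.
have [a aV] : exists a, a \in sub_V H.
  by apply/set0Pn; rewrite -card_gt0; apply: leq_trans V3.
have [y yV ya] : exists2 y, y \in sub_V H & y \notin [set a].
  by apply: big; rewrite cards1; apply: leq_trans V3.
have [_ [x [/set1P-> xa e1E]]] := connected_crossing conH aV yV (set11 a) ya.
have {y yV ya}[z zV zax] : exists2 z, z \in sub_V H & z \notin [set a; x].
  by apply: big; apply: leq_ltn_trans V3; rewrite cards2; case: eqP.
have aax : a \in [set a; x] by rewrite !inE eqxx.
have {z zV zax}[u [w [uax wax e2E]]] := connected_crossing conH aV zV aax zax.
have e12 : [set a; x] != [set u; w].
  by apply: contraNneq wax => ->; rewrite !inE eqxx orbT.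
have EE : sub_E H = [set [set a; x]; [set u; w]].
  apply/esym/eqP; rewrite eqEcard cards2 e12 E2 andbT.
  by apply/subsetP => e; rewrite !inE => /orP[]/eqP->.
(* A further vertex would need an edge leaving [[set a; x; w]], but both edges lie inside this
   set. *)
have VB : sub_V H \subset [set a; x; w].
  apply/subsetP => y yV; apply/negPn/negP => yB.
  have aB : a \in [set a; x; w] by rewrite !inE eqxx.
  have [p [r [pB rB]]] := connected_crossing conH aV yV aB yB.
  rewrite EE !inE => prE.
  have rpr : r \in [set p; r] by rewrite !inE eqxx orbT.
  move: rB; rewrite !inE !negb_or => /andP[/andP[ra rx] rw].
  case/orP: prE rpr => /eqP->;
    rewrite !inE ?(negPf ra) ?(negPf rx) ?(negPf rw)//.
  rewrite orbF => /eqP ru; move: uax.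
  by rewrite -ru !inE (negPf ra) (negPf rx).
split; last by rewrite EE cards2 e12.
apply/esym/eqP; rewrite eqEcard SV S3 (leq_trans (subset_leq_card VB))//.
by rewrite setUC cardsU1 cards2; case: (_ \notin _); case: (_ != _).
Qed.

(* With two colors the trees live inside S, and a triangle has too few edges
   for two disjoint ones. *)
Lemma rx_colorable_ge3 (G : sgraph) (l t : nat) :
  (3 <= #|G|)%N -> (2 <= l)%N -> rx_colorable 3 l G t ->
  (3 <= t)%N.
Proof.
move=> G3 l2 [c ct trees]; rewrite leqNgt; apply/negP => t2.
have [S S3] : exists S : {set G}, #|S| = 3%N.
  exists [set x in take 3 (enum G)]; rewrite cardsE.
  rewrite (card_uniqP (take_uniq _ (enum_uniq _))) size_take -cardE.
  by case: ltnP => // leG3; apply/eqP; rewrite eqn_leq leG3.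
have [T disT rainT] := trees S S3.
have span i : sub_V (T i) = S /\ #|sub_E (T i)| = 2%N.
  have [[conT _] rT ST] := rainT i.
  apply: two_edge_connected_span => //.
  exact: leq_trans (card_rainbow ct rT) _.
pose i0 : 'I_l := Ordinal (ltnW l2); pose i1 : 'I_l := Ordinal l2.
have [E01 _] : sub_E (T i0) :&: sub_E (T i1) = set0 /\ _ := disT i0 i1 isT.
have [[_ E0] [_ E1]] := (span i0, span i1).
have ES i : sub_E (T i) \subset [set e : {set G} | e \subset S & #|e| == 2%N].
  apply/subsetP => e eT; rewrite inE -[in X in _ \subset X](span i).1.
  rewrite (sub_E_V eT); apply/eqP/edges_card2.
  exact: (subsetP (sub_E_sub (T i))).
have : (#|sub_E (T i0) :|: sub_E (T i1)| <= 3)%N.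
  have <- : #|[set e : {set G} | e \subset S & #|e| == 2%N]| = 3%N.
    by rewrite cards_draws S3.
  by apply: subset_leq_card; rewrite subUset !ES.
by rewrite cardsU E01 cards0 E0 E1.
Qed.

Theorem theorem3p3 (R : realType) (eps theta : R) (l : nat)
    (eps_gt0 : 0 < eps) (eps_lt1 : eps < 1)
    (theta_max : is_theta eps theta)
    (l_ge : 2 / 9 * (theta - 3) * (1 - eps) + 1 <= l%:R) :
  forall n : nat,
    Num.max 6%:Z (Num.ceil (9 * (l%:R - 1) / (2 * (1 - eps)) + 3)) <= n%:Z ->
    is_rx 3 l (complete_graph n) 3.
Proof.
move=> n; rewrite ge_max => /andP[]; rewrite lez_nat => n6.
rewrite ceil_le_int pmulrn -lerBrDr => nl.
have eps1 : 0 < 2 * (1 - eps) by lra.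
have theta3 := theta_gt3 eps_gt0 theta_max.
have {}nl : l%:R - 1 <= 2 / 9 * (n%:R - 3) * (1 - eps).
  move: nl; rewrite ler_pdivrMr//; lra.
have l2 : (2 <= l)%N.
  have : 0 < (theta - 3) * (1 - eps) by rewrite mulr_gt0; lra.
  by rewrite -(ltr_nat R); lra.
(* The bounds on l - 1 from below by [theta] and from above by [n] are compared, and the positive
   factor 1 - eps cancels. *)
have theta_n : theta <= n%:R.
  have : (theta - 3) * (1 - eps) <= (n%:R - 3) * (1 - eps) by lra.
  by rewrite ler_pM2r; lra.
split=> [|t]; last by apply: rx_colorable_ge3 => //=; rewrite card_ord; lia.
have n3 : (3 < n)%N by lia.
have [F manyF] := exists_coloring_many_rainbow_stars n3 eps_gt0
  (theta_fun_le1 eps_gt0 theta_max theta_n).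
(* Strictly more than l - 1 rainbow centers means at least l. *)
apply: (@rx_colorable3 _ _ F) => a b c /manyF /(le_lt_trans nl).
by rewrite ltrBlDr natr1 ltr_nat ltnS.
Qed.
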